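(* The universal abelian Polish group $\mathbb{G}_S$ of Shkarin and Niemiec is extremely amenable.
   Context: A norm on an abelian group $G$ (written additively) is a function $\lambda:G\to[0,\infty)$ with $\lambda(a)=0$ iff $a=0$, $\lambda(-a)=\lambda(a)$ and $\lambda(a+b)\le\lambda(a)+\lambda(b)$ for all $a,b\in G$; it induces the invariant metric $d_\lambda(a,b)=\lambda(a-b)$. The group $\mathbb{G}_S$ is constructed as follows. The class of all finite abelian groups equipped with rational-valued norms, with norm-preserving injective homomorphisms as embeddings, is a Fraïssé class. Let $(G_S,\lambda_S)$ be its Fraïssé limit, i.e. the unique (up to norm-preserving isomorphism) countable abelian group with a rational-valued norm such that every finitely generated subgroup is finite, every finite abelian group with a rational-valued norm embeds in it, and every norm-preserving isomorphism between finite subgroups extends to a norm-preserving automorphism. Algebraically $G_S\cong\bigoplus_{\mathbb{N}}\mathbb{Q}/\mathbb{Z}$. Then $\mathbb{G}_S$ is the completion $\overline{(G_S,\lambda_S)}$, that is, the metric completion with respect to $d_{\lambda_S}$ with the group operations and norm extended by continuity. A topological group is extremely amenable if each of its continuous actions on a nonempty compact Hausdorff space has a fixed point. *)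

(* Defs.v *)
From HB Require Import structures.
From mathcomp Require Import all_boot all_order all_algebra.
From mathcomp Require Import all_classical all_reals all_analysis.

Set Implicit Arguments.
Unset Strict Implicit.
Unset Printing Implicit Defensive.

Import Order.TTheory GRing.Theory Num.Theory.

Local Open Scope classical_set_scope.
Local Open Scope ring_scope.

(* MathComp's [normedZmodType] is not usable here: it demands
   `|x *+ n| = `|x| *+ n, which excludes nontrivial torsion groups. *)
Record group_norm (R : numDomainType) (G : zmodType) := GroupNorm {
  gnorm :> G -> R ;
  gnorm_ge0 : forall a, 0 <= gnorm a ;
  gnorm_eq0 : forall a, gnorm a = 0 <-> a = 0 ;
  gnormN : forall a, gnorm (- a) = gnorm a ;
  gnormD : forall a b, gnorm (a + b) <= gnorm a + gnorm b
}.

(* A copy of G carrying the topology and uniformity of the metric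
   (a, b) |-> l (a - b); with it, G is a topological group. *)
Definition metric_group (R : numFieldType) (G : zmodType)
  (l : group_norm R G) : Type := G.

Section metric_group_instances.
Context (R : numFieldType) (G : zmodType) (l : group_norm R G).
Local Notation M := (metric_group l).

HB.instance Definition _ := GRing.Zmodule.copy M G.

Definition group_dist (a b : M) : R := l (a - b).

Let group_distxx a : group_dist a a = 0.
Proof. by apply/gnorm_eq0; rewrite subrr. Qed.

Let group_dist_positivity a b : group_dist a b = 0 -> a = b.
Proof. by move/gnorm_eq0/eqP; rewrite subr_eq0 => /eqP. Qed.

Let group_dist_sym a b : group_dist a b = group_dist b a.
Proof. by rewrite /group_dist -gnormN opprB. Qed.

Let group_dist_triangle b a c :
  group_dist a c <= group_dist a b + group_dist b c.
Proof. by rewrite /group_dist -(subrKA b) gnormD. Qed.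

HB.instance Definition _ := isMetric.Build R M group_distxx
  group_dist_positivity group_dist_sym group_dist_triangle.

Let metric_group_sub_continuous : continuous (fun x : M * M => x.1 - x.2).
Proof.
move=> [a b]; apply/cvg_ballP => e e0; near=> x => /=.
rewrite ballEmdist /= /mdist /= /group_dist.
have -> : a - b - (x.1 - x.2) = (a - x.1) - (b - x.2).
  by rewrite !opprB addrACA [RHS]addrACA [- b + _]addrC.
apply: le_lt_trans (gnormD l _ _) _; rewrite gnormN [ltRHS]splitr.
have [] : ball a (e / 2) x.1 /\ ball b (e / 2) x.2.
  near: x; exists (ball a (e / 2), ball b (e / 2)) => /=.
    by split; apply: nbhsx_ballx; rewrite divr_gt0.
  by move=> x [].
by rewrite !ballEmdist => ? ?; apply: ltrD.
Unshelve. all: by end_near.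
Qed.

HB.instance Definition _ := PreTopologicalNmodule_isTopologicalZmodule.Build M
  metric_group_sub_continuous.

End metric_group_instances.

Definition is_subgroup (G : zmodType) (A : set G) : Prop :=
  zmod_closed (mem A).

Definition locally_finite_group (G : zmodType) : Prop :=
  forall s : seq G, finite_set (smallest (@is_subgroup G) [set` s]).

Definition norm_preserving (R : numDomainType) (F G : zmodType)
    (m : group_norm R F) (l : group_norm R G) (f : F -> G) : Prop :=
  forall x, l (f x) = m x.

Definition universal_for_finite_groups (G : zmodType) (l : group_norm rat G) :=
  forall (F : finZmodType) (m : group_norm rat F),
    exists f : {additive F -> G}, injective f /\ norm_preserving m l f.

(* A map between subsets A and B of G is encoded as a total function on G, of
   which only the restriction to A matters. *)
Definition finite_homogeneous (G : zmodType) (l : group_norm rat G) :=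
  forall (A B : set G) (f : G -> G),
    is_subgroup A -> finite_set A -> is_subgroup B -> finite_set B ->
    set_bij A B f -> {in A &, {morph f : x y / x + y}} ->
    {in A, forall x, l (f x) = l x} ->
    exists g : {additive G -> G},
      [/\ bijective g, norm_preserving l l g & {in A, g =1 f}].

Definition fraisse_limit (G : zmodType) (l : group_norm rat G) : Prop :=
  [/\ countable [set: G], locally_finite_group G,
      universal_for_finite_groups l & finite_homogeneous l].

(* The class [completeType] is not used because it requires a chosen point. *)
Definition complete_group (R : numFieldType) (G : zmodType)
    (l : group_norm R G) : Prop :=
  forall F : set_system (metric_group l), ProperFilter F -> cauchy F ->
    exists x : metric_group l, F --> x.

(* The density of the image forces the operations and the norm of H to be the
   continuous extensions of those of G. *)
Definition is_completion (R : realType) (G : zmodType) (l : group_norm rat G)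
    (H : zmodType) (m : group_norm R H) : Prop :=
  complete_group m /\
  exists j : {additive G -> H},
    (forall x, m (j x) = ratr (l x)) /\
    dense (range j : set (metric_group m)).

Definition is_continuous_action (G : topologicalZmodType) (X : topologicalType)
    (act : G -> X -> X) : Prop :=
  [/\ forall x, act 0 x = x,
      forall g h x, act (g + h) x = act g (act h x) &
      continuous (fun p : G * X => act p.1 p.2)].

Definition extremely_amenable (G : topologicalZmodType) : Prop :=
  forall (X : topologicalType) (act : G -> X -> X),
    [set: X] !=set0 -> compact [set: X] -> hausdorff_space X ->
    is_continuous_action act -> exists x, forall g, act g x = x.

(* Main.v *)
Require Import Defs.
From HB Require Import structures.
From mathcomp Require Import all_boot all_order all_algebra.
From mathcomp Require Import all_classical all_reals all_analysis.
From mathcomp Require Import ring lra.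

(** Extreme amenability of an abelian topological group follows from a
    statement about coverings: whenever G is covered by finitely many sets C_i,
    each paired with an element g_i, some C_i contains two points whose
    difference is as close to g_i as desired ([covers_return]).  Indeed, an
    action on a compact Hausdorff space X without fixed points provides a
    finite open cover of X by sets U_i and elements g_i such that every element
    close to g_i moves U_i off itself; pulling the U_i back along an orbit map
    gives a covering of G that violates the property
    ([covers_return_extremely_amenable]).

    For the Fraisse limit the property comes from concentration of measure.
    The elements g_i generate a finite subgroup F.  The diagonal map embeds F
    into F * F with the averaged norm, preserving norms, while the bound on the
    variance of 1-Lipschitz functions is divided by 2 ([variance_le_avg]): the
    real line satisfies the inequality bounding the squared diagonals of a
    quadrilateral by its squared sides, so variance is subadditive on products,
    and averaging makes functions 1/2-Lipschitz in each coordinate.  Iterating,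
    F embeds into a finite normed group K with arbitrarily small variance
    ([small_variance_extension]).  In such a K two sets of non-negligible
    proportion are close to each other, since otherwise the distance to one of
    them would have large variance; for the sets C_i and C_i + g_i this is the
    covering property in K ([finite_cover_returns]).  By universality and
    homogeneity K is realised inside the Fraisse limit as an extension of F
    itself ([fraisse_extension]), and the property passes to the completion by
    density ([completion_covers_return]). *)

Set Implicit Arguments.
Unset Strict Implicit.
Unset Printing Implicit Defensive.

Import Order.TTheory GRing.Theory Num.Theory.

Local Open Scope classical_set_scope.
Local Open Scope ring_scope.

(** * Variance of Lipschitz functions on finite normed groups *)

Section FiniteVariance.
Context (R : realFieldType).

Definition lipschitz_wrt (G : zmodType) (m : group_norm R G) (f : G -> R) :=
  forall x y, `|f x - f y| <= m (x - y).

(** For a uniform random element of K, this bounds twice the variance of every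
    1-Lipschitz function by c. *)
Definition variance_le (K : finZmodType) (m : group_norm R K) (c : R) :=
  forall f : K -> R, lipschitz_wrt m f ->
    \sum_x \sum_y (f x - f y) ^+ 2 <= c * #|K|%:R ^+ 2.

Lemma variance_le_finite (K : finZmodType) (m : group_norm R K) :
  exists c, variance_le m c.
Proof.
exists (\sum_x \sum_y m (x - y) ^+ 2) => f flip.
have sum_ge0 : 0 <= \sum_x \sum_y m (x - y) ^+ 2.
  by apply: sumr_ge0 => x _; apply: sumr_ge0 => y _; apply: sqr_ge0.
have K1 : 1 <= #|K|%:R ^+ 2 :> R.
  by rewrite exprn_ege1// ler1n; apply/card_gt0P; exists 0.
apply: le_trans (ler_peMr sum_ge0 K1).
apply: ler_sum => x _; apply: ler_sum => y _.
by rewrite -[leLHS]real_normK ?num_real// ler_sqr ?nnegrE ?gnorm_ge0 ?flip.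
Qed.

Section AveragedNorm.
Context (G : zmodType) (m : group_norm R G).

Definition avg_norm_fun (x : G * G) : R := (m x.1 + m x.2) / 2.

Let avg_ge0 x : 0 <= avg_norm_fun x.
Proof. by rewrite divr_ge0 ?addr_ge0 ?gnorm_ge0. Qed.

Let avg_eq0 x : avg_norm_fun x = 0 <-> x = 0.
Proof.
split=> [|->]; last first.
  by rewrite /avg_norm_fun /= (gnorm_eq0 m 0).2// addr0 mul0r.
case: x => x y; rewrite /avg_norm_fun /= => /eqP.
rewrite mulf_eq0 invr_eq0 pnatr_eq0 orbF paddr_eq0 ?gnorm_ge0//.
by move=> /andP[/eqP/gnorm_eq0-> /eqP/gnorm_eq0->].
Qed.

Let avgN x : avg_norm_fun (- x) = avg_norm_fun x.
Proof. by rewrite /avg_norm_fun /= !gnormN. Qed.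

Let avgD x y : avg_norm_fun (x + y) <= avg_norm_fun x + avg_norm_fun y.
Proof.
rewrite /avg_norm_fun -mulrDl ler_pM2r ?invr_gt0//= addrACA.
by apply: lerD; apply: gnormD.
Qed.

Definition avg_norm := GroupNorm avg_ge0 avg_eq0 avgN avgD.

Definition diag (x : G) : G * G := (x, x).

Let diag_is_zmod_morphism : zmod_morphism diag.
Proof. by []. Qed.

HB.instance Definition _ := GRing.isZmodMorphism.Build G (G * G)%type diag
  diag_is_zmod_morphism.

Lemma diag_norm_preserving : norm_preserving m avg_norm diag.
Proof. by move=> x; rewrite /= /avg_norm_fun /=; lra. Qed.

End AveragedNorm.

Section FinitePairs.
Context (F : finZmodType).
HB.instance Definition _ := GRing.Zmodule.on (F * F)%type.
End FinitePairs.

(** The difference of the two sides is (a - b - c + d)^2. *)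
Lemma quadrilateral (a b c d : R) :
  (a - d) ^+ 2 + (b - c) ^+ 2 <=
  ((a - b) ^+ 2 + (c - d) ^+ 2) + ((a - c) ^+ 2 + (b - d) ^+ 2).
Proof. by have := sqr_ge0 (a - b - c + d); lra. Qed.

(** Summing [quadrilateral] over the rectangles with corners (x, y), (x', y),
    (x, y'), (x', y') bounds the two diagonals, which contribute equally, by
    the four sides.  Along a side f varies in one coordinate only, where it is
    1/2-Lipschitz, so a side contributes at most c / 4 on average. *)
Lemma variance_le_avg (K : finZmodType) (m : group_norm R K) (c : R) :
  variance_le m c -> variance_le (avg_norm m) (c / 2).
Proof.
move=> mc f flip; pose n : R := #|K|%:R.
have cardKK : #|((K * K)%type : finType)|%:R = n ^+ 2 :> R.
  by rewrite card_prod natrM expr2.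
have scaled (h : K -> R) : (forall x y, `|h x - h y| <= m (x - y) / 2) ->
    \sum_(p : K * K) (h p.1 - h p.2) ^+ 2 <= c / 4 * n ^+ 2.
  move=> hlip.
  have hlip2 : lipschitz_wrt m (fun x => 2 * h x).
    move=> x y; have := hlip x y.
    by rewrite -mulrBr normrM (ger0_norm (ler0n R 2)); lra.
  rewrite -(pair_bigA _ (fun x y => (h x - h y) ^+ 2)) /=.
  have -> : \sum_x \sum_y (h x - h y) ^+ 2 =
            (\sum_x \sum_y (2 * h x - 2 * h y) ^+ 2) / 4.
    rewrite mulr_suml; apply: eq_bigr => x _; rewrite mulr_suml.
    by apply: eq_bigr => y _; field.
  by have := mc _ hlip2; rewrite -/n; lra.
have lip1 y x x' : `|f (x, y) - f (x', y)| <= m (x - x') / 2.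
  by have := flip (x, y) (x', y); rewrite /= /avg_norm_fun /= subrr
    (gnorm_eq0 m 0).2// addr0.
have lip2 x y y' : `|f (x, y) - f (x, y')| <= m (y - y') / 2.
  by have := flip (x, y) (x, y'); rewrite /= /avg_norm_fun /= subrr
    (gnorm_eq0 m 0).2// add0r.
have bound (F : K * K -> R) (b : R) : (forall p, F p <= b) ->
    \sum_p F p <= n ^+ 2 * b.
  move=> Fb; rewrite -cardKK mulr_natl -sumr_const.
  exact: ler_sum.
have vert (j : K * K -> K) : \sum_(p : K * K) \sum_(q : K * K)
    (f (p.1, j q) - f (p.2, j q)) ^+ 2 <= n ^+ 2 * (c / 4 * n ^+ 2).
  rewrite exchange_big; apply: bound => q.
  by apply: (scaled (fun x => f (x, j q))) => x y; apply: lip1.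
have horz (i : K * K -> K) : \sum_(p : K * K) \sum_(q : K * K)
    (f (i p, q.1) - f (i p, q.2)) ^+ 2 <= n ^+ 2 * (c / 4 * n ^+ 2).
  apply: bound => p.
  by apply: (scaled (fun x => f (i p, x))) => x y; apply: lip2.
(* In S the summation variables are grouped by coordinate, p listing the two
   first coordinates and q the two second ones. *)
pose S := \sum_(p : K * K) \sum_(q : K * K)
  (f (p.1, q.1) - f (p.2, q.2)) ^+ 2.
have -> : \sum_x \sum_y (f x - f y) ^+ 2 = S.
  rewrite /S !pair_bigA /=.
  pose tr (w : (K * K) * (K * K)) := ((w.1.1, w.2.1), (w.1.2, w.2.2)).
  have trK : involutive tr by move=> [[? ?] [? ?]].
  rewrite (reindex_inj (inv_inj trK)) /=.
  by apply: eq_bigr => -[[? ?] [? ?]] _ //=.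
have swapS : \sum_(p : K * K) \sum_(q : K * K)
    (f (p.2, q.1) - f (p.1, q.2)) ^+ 2 = S.
  pose sw (p : K * K) := (p.2, p.1).
  have swK : involutive sw by move=> [].
  by rewrite (reindex_inj (inv_inj swK)).
rewrite cardKK; suff : S + S <= 4 * (n ^+ 2 * (c / 4 * n ^+ 2)) by lra.
have := lerD (lerD (vert fst) (vert snd)) (lerD (horz fst) (horz snd)).
move=> sides; apply: (le_trans _ (le_trans sides _)); last by lra.
rewrite -{2}swapS -!big_split /=; apply: ler_sum => p _.
rewrite -!big_split /=; apply: ler_sum => q _; exact: quadrilateral.
Qed.

End FiniteVariance.

(** Iterated diagonal embeddings K -> K * K, each dividing the variance bound
    by 2. *)
Lemma small_variance_extension (R : archiRealFieldType) (F : finZmodType)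
    (m : group_norm R F) (e : R) : 0 < e ->
  exists (K : finZmodType) (mK : group_norm R K) (i : {additive F -> K}),
    norm_preserving m mK i /\ variance_le mK e.
Proof.
move=> e0; have [c mc] := variance_le_finite m.
have iter k : exists (K : finZmodType) (mK : group_norm R K)
    (i : {additive F -> K}),
    norm_preserving m mK i /\ variance_le mK (c / 2 ^+ k).
  elim: k => [|k [K [mK [i [ipres mKc]]]]].
    by exists F, m, idfun; split=> //; rewrite expr0 divr1.
  exists (K * K)%type, (avg_norm mK), (@diag K \o i); split.
    by move=> x; apply: etrans (diag_norm_preserving mK (i x)) (ipres x).
  by rewrite exprSr invfM mulrA; apply: variance_le_avg.
pose k := Num.truncn (c / e); have [K [mK [i [ipres mKc]]]] := iter k.
exists K, mK, i; split=> // f /mKc /le_trans; apply.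
rewrite ler_wpM2r ?exprn_ge0// ler_pdivrMr ?exprn_gt0// mulrC -ler_pdivrMr//.
have /ltW/le_trans := truncnS_gt (c / e); apply.
by rewrite -/k -natrX ler_nat ltn_expl.
Qed.

(** * Covers of finite groups of small variance *)

Section LargeSets.
Context (R : realFieldType) (K : finZmodType) (m : group_norm R K) (c : R).
Hypothesis mc : variance_le m c.

Let c_ge0 : 0 <= c.
Proof.
have K0 : 0 < #|K|%:R ^+ 2 :> R.
  by rewrite exprn_gt0// ltr0n; apply/card_gt0P; exists 0.
have lip0 : lipschitz_wrt m (fun=> 0).
  by move=> x y; rewrite subrr normr0 gnorm_ge0.
rewrite -(pmulr_lge0 _ K0); apply: le_trans (mc lip0).
by apply: sumr_ge0 => x _; apply: sumr_ge0 => y _; apply: sqr_ge0.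
Qed.

(** If every point of B were at distance at least e from A, the distance to A
    would be a 1-Lipschitz function equal to 0 on A and at least e on B, which
    already accounts for the right-hand side in its variance. *)
Lemma large_sets_close (A B : {set K}) (e : R) : 0 < e ->
  c * #|K|%:R ^+ 2 < #|A|%:R * #|B|%:R * e ^+ 2 ->
  exists a b, [/\ a \in A, b \in B & m (a - b) < e].
Proof.
move=> e0 large; have [A0|[a0 a0A]] := set_0Vmem A.
  by move: large; rewrite A0 cards0 !mul0r ltNge mulr_ge0// exprn_ge0.
apply: contrapT => far.
have {}far a b : a \in A -> b \in B -> e <= m (b - a).
  move=> aA bB; rewrite leNgt; apply/negP => ab; apply: far.
  by exists a, b; split=> //; rewrite -gnormN opprB.
pose near x := [arg min_(a < a0 in A) m (x - a)]%O.
pose f x := m (x - near x).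
have nearA x : near x \in A by rewrite /near; case: arg_minP.
have f_le x a : a \in A -> f x <= m (x - a).
  by rewrite /f /near; case: arg_minP => // ? _; apply.
have f_lip1 x y : f x - f y <= m (x - y).
  rewrite lerBlDr; apply: le_trans (f_le x _ (nearA y)) _.
  by rewrite -(subrKA y) gnormD.
have f_lip : lipschitz_wrt m f.
  move=> x y; rewrite ler_norml f_lip1 andbT lerNl opprB.
  by rewrite -gnormN opprB f_lip1.
have := mc f_lip; apply/negP; rewrite -ltNge; apply: lt_le_trans large _.
have f_eq0 x : x \in A -> f x = 0.
  move=> xA; apply/le_anti; rewrite gnorm_ge0 andbT.
  by rewrite (le_trans (f_le _ _ xA))// subrr (gnorm_eq0 m 0).2.
have -> : #|A|%:R * #|B|%:R * e ^+ 2 = \sum_(x in A) \sum_(y in B) e ^+ 2.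
  rewrite !sumr_const -mulrnA -[RHS]mulr_natl natrM.
  by rewrite [#|B|%:R * _]mulrC.
(* Only the pairs in A * B are kept. *)
rewrite [leRHS](bigID (mem A)) /= ler_wpDr//.
  by apply: sumr_ge0 => x _; apply: sumr_ge0 => y _; apply: sqr_ge0.
apply: ler_sum => x xA.
rewrite [leRHS](bigID (mem B)) /= ler_wpDr//.
  by apply: sumr_ge0 => y _; apply: sqr_ge0.
apply: ler_sum => y yB; rewrite f_eq0// sub0r sqrrN ler_sqr ?nnegrE ?(ltW e0)//.
  exact: far.
exact: gnorm_ge0.
Qed.

(** One of the sets C i contains at least a proportion 1 / size s of K, and so
    does its translate by g i; both are large enough to be close. *)
Lemma finite_cover_returns (T : eqType) (s : seq T) (C : T -> {set K})
    (g : T -> K) (e : R) : 0 < e -> c * (size s)%:R ^+ 2 < e ^+ 2 ->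
  (forall x, exists2 i, i \in s & x \in C i) ->
  exists i a b, [/\ i \in s, a \in C i, b \in C i & m (a - b - g i) < e].
Proof.
move=> e0 small cover.
have [i si largeC] : exists2 i, i \in s & (#|K| <= size s * #|C i|)%N.
  apply: contrapT => none.
  have sumC : (#|K| <= \sum_(i <- s) #|C i|)%N.
    have -> : (\sum_(i <- s) #|C i| =
               \sum_(x : K) \sum_(i <- s) (x \in C i))%N.
      rewrite exchange_big; apply: eq_bigr => i _.
      by rewrite -sum1_card big_mkcond; apply: eq_bigr => x _;
         case: (x \in C i).
    rewrite -sum1_card; apply: leq_sum => x _; have [i si xi] := cover x.
    by rewrite (big_rem i)//= xi.
  have : (\sum_(i <- s) (size s * #|C i|).+1 <= \sum_(i <- s) #|K|)%N.
    rewrite !big_seq; apply: leq_sum => i si.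
    by rewrite ltnNge; apply/negP => ?; apply: none; exists i.
  rewrite big_const_seq count_predT iter_addn_0 mulnC.
  under eq_bigr do rewrite -addn1.
  rewrite big_split /= -big_distrr /= sum1_size.
  apply/negP; rewrite -ltnNge;
    apply: (@leq_ltn_trans (size s * \sum_(i <- s) #|C i|)).
    by rewrite leq_mul2l sumC orbT.
  by rewrite -[ltnLHS]addn0 ltn_add2l; case: (cover 0) => i; case: (s).
have s0 : (0 < size s)%N by case: (s) si.
pose B := [set b + g i | b in C i]%SET.
have cardB : #|B| = #|C i| by rewrite card_imset//; apply: addIr.
have K0 : (0 < #|K|)%N by apply/card_gt0P; exists 0.
have [a [b' [aC /imsetP[b bC ->] ab]]] : exists a b,
    [/\ a \in C i, b \in B & m (a - b) < e].
  apply: large_sets_close => //; rewrite cardB.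
  have : (#|K|%:R : R) <= (size s)%:R * #|C i|%:R by rewrite -natrM ler_nat.
  rewrite -(ler_sqr (ler0n _ _)) ?nnegrE ?mulr_ge0//.
  move=> /(ler_wpM2l c_ge0)/le_lt_trans; apply.
  rewrite exprMn mulrA -expr2 [ltRHS]mulrC ltr_pM2r// exprn_gt0// ltr0n.
  by move: (leq_trans K0 largeC); rewrite muln_gt0 => /andP[].
by exists i, a, b; split=> //; rewrite -addrA -opprD.
Qed.

End LargeSets.

(** * Finite subgroups and extensions inside the Fraisse limit *)

Section FiniteSubgroup.
Context (G : zmodType) (A : set G) (sA : is_subgroup A) (fA : finite_set A).

(** The two hypotheses are arguments so that the instances below can be inferred
    from the type. *)
Definition finite_subgroup of is_subgroup A & finite_set A : Type :=
  {x : G | x \in A}.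
Local Notation H := (finite_subgroup sA fA).

HB.instance Definition _ := SubChoice.on H.

Let elements : seq H := undup (pmap insub (sval (cid ((finite_seqP A).1 fA)))).

Let elementsP : Finite.axiom elements.
Proof.
move=> x; rewrite count_uniq_mem ?undup_uniq//.
rewrite mem_undup mem_pmap_sub /=.
case: cid => s /= As.
have s_of_A y : y \in A -> y \in s by rewrite As inE.
by rewrite (s_of_A _ (valP x)).
Qed.

HB.instance Definition _ := isCountable.Build H (fin_pickleK (f := elementsP)).
HB.instance Definition _ := fintype.isFinite.Build H elementsP.
HB.instance Definition _ :=
  GRing.SubChoice_isSubZmodule.Build G (in_mem^~ (mem A)) H sA.

Lemma finite_subgroup_valP (x : H) : A (val x).
Proof. by have := valP x; rewrite inE. Qed.

Section InducedNorm.
Context (R : numDomainType) (l : group_norm R G).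

Let ind_ge0 (x : H) : 0 <= l (val x).
Proof. exact: gnorm_ge0. Qed.

Let ind_eq0 (x : H) : l (val x) = 0 <-> x = 0.
Proof.
rewrite gnorm_eq0; split=> [x0|->]; last by rewrite raddf0.
by apply: val_inj; rewrite raddf0.
Qed.

Let indN (x : H) : l (val (- x)) = l (val x).
Proof. by rewrite raddfN gnormN. Qed.

Let indD (x y : H) : l (val (x + y)) <= l (val x) + l (val y).
Proof. by rewrite raddfD gnormD. Qed.

Definition induced_norm : group_norm R H := GroupNorm ind_ge0 ind_eq0 indN indD.

End InducedNorm.
End FiniteSubgroup.

Lemma norm_preserving_inj (R : numDomainType) (F G : zmodType)
    (m : group_norm R F) (l : group_norm R G) (f : {additive F -> G}) :
  norm_preserving m l f -> injective f.
Proof.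
move=> fpres; apply: raddf_inj => x fx0; apply/(gnorm_eq0 m).
by rewrite -fpres fx0 (gnorm_eq0 l 0).2.
Qed.

(** Universality embeds K somewhere in G, taking A to a copy of A.  Homogeneity
    extends the isomorphism from A to that copy to an automorphism of G, and
    composing the embedding with its inverse puts A back in place. *)
Lemma fraisse_extension (G : zmodType) (l : group_norm rat G)
    (A : set G) (sA : is_subgroup A) (fA : finite_set A)
    (K : finZmodType) (m : group_norm rat K)
    (i : {additive finite_subgroup sA fA -> K}) :
  universal_for_finite_groups l -> finite_homogeneous l ->
  norm_preserving (induced_norm sA fA l) m i ->
  exists h : {additive K -> G}, norm_preserving m l h /\ h \o i =1 val.
Proof.
move=> univ homog ipres; have [h [hinj hpres]] := univ K m.
pose f x := h (i (insubd 0 x)).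
have fval (x : finite_subgroup sA fA) : f (val x) = h (i x).
  by rewrite /f valKd.
have fA_val x : x \in A -> exists y : finite_subgroup sA fA, x = val y.
  by move=> xA; exists (Sub x xA); rewrite SubK.
pose B := f @` A.
have BP x : x \in B -> exists y : finite_subgroup sA fA, x = h (i y).
  by rewrite inE => -[y /mem_set/fA_val[z ->] <-]; exists z; rewrite fval.
have Bhi y : h (i y) \in B.
  by rewrite inE -fval; exists (val y) => //; exact: finite_subgroup_valP.
have sB : is_subgroup B.
  split=> [|x y /BP[x' ->] /BP[y' ->]].
    by rewrite -(raddf0 h) -(raddf0 i) Bhi.
  by rewrite -!raddfB Bhi.
have [|||g [gbij gpres gf]] := homog A B f sA fA sB (finite_image f fA).
- apply: inj_bij => x y /fA_val[x' ->] /fA_val[y' ->].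
  by rewrite !fval => /hinj/(norm_preserving_inj ipres)->.
- move=> x y /fA_val[x' ->] /fA_val[y' ->].
  by rewrite -raddfD !fval !raddfD.
- by move=> x /fA_val[x' ->]; rewrite fval hpres ipres.
have [g' gK g'K] := gbij.
have g'_additive : zmod_morphism g' := can2_zmod_morphism gK g'K.
pose gi : {additive G -> G} :=
  HB.pack g' (GRing.isZmodMorphism.Build G G g' g'_additive).
exists (gi \o h); split=> x /=.
  by rewrite -hpres -(g'K (h x)) -[X in _ = l X]/(g (g' (h x))) gpres g'K.
by rewrite -fval -gf ?gK//; exact: valP.
Qed.

(** * The covering property *)

(** A combinatorial form of extreme amenability.  Each set C i is only asked
    about its own element g i, rather than one set about all of them at once;
    this is already enough for fixed points. *)
Definition covers_return (R : numDomainType) (G : zmodType)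
    (l : group_norm R G) :=
  forall (T : eqType) (s : seq T) (C : T -> set G) (g : T -> G) (e : R),
    0 < e -> (forall x, exists2 i, i \in s & C i x) ->
    exists i a b, [/\ i \in s, C i a, C i b & l (a - b - g i) < e].

(** The covering is transported to a finite group K of small variance that
    extends the subgroup generated by the g i and sits inside G. *)
Lemma fraisse_covers_return (G : zmodType) (l : group_norm rat G) :
  fraisse_limit l -> covers_return l.
Proof.
move=> [_ locfin univ homog] T s C g e e0 cover.
pose A := smallest (@is_subgroup G) [set` map g s].
have fA : finite_set A := locfin (map g s).
have sA : is_subgroup A.
  split=> [|x y]; rewrite !inE.
    by move=> D [[D0 _] _]; move: D0; rewrite inE.
  move=> Ax Ay D [sD gD]; have := sD.2 x y; rewrite !inE; apply.
  - exact: Ax.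
  - exact: Ay.
have gA i : i \in s -> g i \in A.
  by move=> si; rewrite inE => D [_]; apply; rewrite /= map_f.
(* The factor 1 / 2 makes the inequality of [finite_cover_returns] strict. *)
have d0 : 0 < e ^+ 2 / (size s)%:R ^+ 2 / 2 :> rat.
  have s0 : (0 < size s)%N by case: (cover 0) => i; case: (s).
  by rewrite !divr_gt0// exprn_gt0// ltr0n.
have [K [mK [j [jpres mKe]]]] :=
  small_variance_extension (induced_norm sA fA l) d0.
have [h [hpres hj]] := fraisse_extension univ homog jpres.
pose gK i := j (insubd 0 (g i)).
have [||i [a [b [si]]]] := finite_cover_returns mKe (s := s)
  (C := fun i => [set x | h x \in C i]%SET) gK e0.
- have s0 : (0 < size s)%N by case: (cover 0) => i; case: (s).
  rewrite mulrAC divfK ?expf_neq0 ?pnatr_eq0 -?lt0n//.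
  by rewrite ltr_pdivrMr// ltr_pMr ?exprn_gt0// ltr1n.
- by move=> x; have [i si Ci] := cover (h x); exists i; rewrite // !inE.
rewrite !inE => Ca Cb ab; exists i, (h a), (h b); split=> //.
suff -> : g i = h (gK i) by rewrite -!raddfB hpres.
by rewrite [RHS]hj val_insubd gA.
Qed.

Lemma metric_group_ballE (R : numFieldType) (G : zmodType) (l : group_norm R G)
    (x y : metric_group l) (e : R) :
  ball x e y = (l (x - y) < e) :> Prop.
Proof. by rewrite ballEmdist. Qed.

(** Replacing g i by a nearby element j (g' i) of the dense subgroup costs
    e / 2; the other half is left for the covering property of G. *)
Lemma completion_covers_return (R : realType) (G H : zmodType)
    (l : group_norm rat G) (m : group_norm R H) :
  is_completion l m -> covers_return l -> covers_return m.
Proof.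
move=> [_ [j [jpres jdense]]] lreturn T s C g e e0 cover.
have approx x : exists y, m (j y - x) < e / 2.
  have [||z [xz [y _ yz]]] := jdense (ball (x : metric_group m) (e / 2))^°.
  - exists x; apply: nbhsx_ballx; exact: divr_gt0.
  - exact: open_interior.
  move: xz => /interior_subset; rewrite -yz metric_group_ballE => xy.
  by exists y; rewrite -gnormN opprB.
have /choice[g' g'P] i : exists y, m (j y - g i) < e / 2 := approx (g i).
have [q] := rat_in_itvoo (divr_gt0 e0 (ltr0n R 2)).
rewrite in_itv /= ltr0q => /andP[q0 qe].
have [x|i [a [b [si Ca Cb ab]]]] :=
  lreturn T s (fun i => j @^-1` C i) g' q q0.
  by have [i si Ci] := cover (j x); exists i.
exists i, (j a), (j b); split=> //.
rewrite -(subrKA (j (g' i))) [ltRHS]splitr.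
apply: le_lt_trans (gnormD _ _ _) _; apply: ltrD; last exact: g'P.
by rewrite -!raddfB jpres (lt_trans _ qe)// ltr_rat.
Qed.

Lemma seq_uniform_radius (R : realDomainType) (T : eqType) (e : T -> R)
    (s : seq T) :
  (forall i, 0 < e i) -> exists2 d, 0 < d & forall i, i \in s -> d <= e i.
Proof.
move=> e0; elim: s => [|j s [d d0 dP]]; first by exists 1.
exists (Order.min d (e j)) => [|i]; first by rewrite lt_min d0 e0.
by rewrite inE ge_min => /predU1P[->|/dP->]; rewrite ?lexx ?orbT.
Qed.

(** * Fixed points *)

(** Without fixed points, every x has a neighbourhood U x and an element g x
    such that all h close to g x map U x off U x.  Finitely many U x cover X,
    hence their preimages under the orbit map of x0 cover G.  For a and b in
    one of these preimages, a - b maps b x0 to a x0 inside the same U x, so it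
    cannot be close to g x. *)
Lemma covers_return_extremely_amenable (R : realType) (G : zmodType)
    (l : group_norm R G) :
  covers_return l -> extremely_amenable (metric_group l).
Proof.
move=> return_l X act [x0 _] Xcompact Xhausdorff [act0 actD actC].
apply: contrapT => nofix.
have escape x : exists (g : metric_group l) (U : set X) (e : R),
    [/\ open U, U x, 0 < e &
      forall h y z, U y -> l (h - g) < e -> U z -> act h y <> z].
  have [g gx] : exists g, act g x != x.
    apply: contrapT => allfix; apply: nofix; exists x => g.
    by apply: contrapT => /eqP gx; apply: allfix; exists g.
  move: Xhausdorff; rewrite open_hausdorff => /(_ _ _ gx).
  move=> [[Q P]] /= [/set_mem Qgx /set_mem Px] [oQ oP /eqP QP].
  have [[V U] /= [nV nU] VUQ] := actC (g, x) Q (open_nbhs_nbhs (conj oQ Qgx)).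
  move: nV => /nbhs_ballP[e /= e0 eV].
  exists g, (U^° `&` P), e; split=> //.
    by apply: openI => //; exact: open_interior.
  move=> h y z [/interior_subset Uy _] hg [_ Pz] hyz.
  suff : (Q `&` P) z by rewrite QP.
  split=> //; rewrite -hyz; apply: (VUQ (h, y)); split=> //=.
  by apply: eV; rewrite metric_group_ballE -gnormN opprB.
have [g /choice[U /choice[e escP]]] := choice escape.
(* [compact_cover] is about pointed spaces; x0 serves as the point. *)
pose pX : ptopologicalType :=
  HB.pack (Topological.sort X) (isPointed.Build X x0).
have Xcover : @cover_compact pX [set: X] by rewrite -compact_cover.
have [|x _|E _ XE] := Xcover X [set: X] U.
- by move=> x _; have [] := escP x.
- by exists x => //; have [] := escP x.
pose s := finmap.enum_fset E.
have [|d d0 dP] := @seq_uniform_radius _ _ e s.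
  by move=> x; have [] := escP x.
have [x|i [a [b [si Ua Ub ab]]]] :=
  return_l X s (fun i h => U i (act h x0)) g d d0.
  by have [i /= si Ui] := XE (act x x0) I; exists i.
have [_ _ _ /(_ (a - b) _ _ Ub)] := escP i.
move=> /(_ _ (lt_le_trans ab (dP i si)) Ua); apply.
by rewrite -actD subrK.
Qed.

Theorem corollary0p4 (R : realType)
    (G_S : zmodType) (lambda_S : group_norm rat G_S)
    (GG_S : zmodType) (lambda : group_norm R GG_S)
    (hG_S : fraisse_limit lambda_S)
    (hGG_S : is_completion lambda_S lambda) :
  extremely_amenable (metric_group lambda).
Proof.
apply: covers_return_extremely_amenable.
exact: completion_covers_return hGG_S (fraisse_covers_return hG_S).
Qed.
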